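(* For all $\mathcal G_1,\mathcal G_2\in\mathbb A^{p,q}$, \[\#(\mathcal G_1\otimes\mathcal G_2)+\#\mathcal G_0\ \le\ \#\mathcal G_1+\#\mathcal G_2,\] where $\#$ denotes cardinality.
   Context: Fix integers $p,q\ge 2$ (polynomial degrees) and positive integers $M,N$. Initial mesh: $\mathcal G_0=\{[m-1,m]\times[n-1,n]\mid 1\le m\le M,\ 1\le n\le N\}$, and $\overline\Omega=\bigcup\mathcal G_0=[0,M]\times[0,N]$. Elements are closed axis-parallel rectangles; a mesh is a set of elements obtained from $\mathcal G_0$ by bisections as defined below. Level: $\ell(K)=-\log_2|K|$, where $|K|$ is the area of $K$. Distance: for elements $K_1,K_2$, $\operatorname{Dist}(K_1,K_2)\in\mathbb R^2$ is the componentwise absolute value of $\operatorname{mid}(K_1)-\operatorname{mid}(K_2)$, where $\operatorname{mid}$ denotes the midpoint. Inequalities between vectors are componentwise. Patch: $\mathcal G^{p,q}(K)=\{K'\in\mathcal G\mid \operatorname{Dist}(K',K)\le \mathbf D^{p,q}(\ell(K))\}$, where $\mathbf D^{p,q}(k)=2^{-k/2}\bigl(\lfloor p/2\rfloor+\tfrac12,\ \lceil q/2\rceil+\tfrac12\bigr)$ if $k$ is even and $\mathbf D^{p,q}(k)=2^{-(k+1)/2}\bigl(\lceil p/2\rceil+\tfrac12,\ 2\lfloor q/2\rfloor+1\bigr)$ if $k$ is odd. Bisection: for $K=[\mu,\mu+\tilde\mu]\times[\nu,\nu+\tilde\nu]$, $\operatorname{child}(K)$ is the pair of rectangles obtained by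 halving $K$ in the $x$-direction (i.e. cutting along $x=\mu+\tilde\mu/2$) if $\ell(K)$ is even, and by halving $K$ in the $y$-direction (cutting along $y=\nu+\tilde\nu/2$) if $\ell(K)$ is odd. For $K\in\mathcal G$, $\operatorname{bisect}(\mathcal G,K)=(\mathcal G\setminus\{K\})\cup\operatorname{child}(K)$; for $\mathcal M=\{K_1,\dots,K_J\}\subseteq\mathcal G$, $\operatorname{bisect}(\mathcal G,\mathcal M)$ is the result of successively bisecting $K_1,\dots,K_J$ (in arbitrary order). Admissibility: the bisection of $K\in\mathcal G$ is admissible if all $K'\in\mathcal G^{p,q}(K)$ satisfy $\ell(K')\ge\ell(K)$. The bisection $\operatorname{bisect}(\mathcal G,\mathcal M)$ of several elements is admissible if the elements of $\mathcal M$ can be ordered such that it is a concatenation of admissible bisections of single elements (each with respect to the current mesh). A mesh $\mathcal G$ is admissible if it is $\mathcal G_0$ or there are meshes $\mathcal G_1,\dots,\mathcal G_J=\mathcal G$ and sets $\mathcal M_j\subseteq\mathcal G_j$ such that $\mathcal G_{j+1}=\operatorname{bisect}(\mathcal G_j,\mathcal M_j)$ is an admissible bisection for $j=0,\dots,J-1$. $\mathbb A^{p,q}$ is the set of all admissible meshes. Overlay: for a set $\mathcal S$ of elements, $\operatorname{Min}_\subseteq(\mathcal S)=\{K\in\mathcal S\mid\forall K'\in\mathcal S:\ K'\subseteq K\Rightarrow K'=K\}$, and $\mathcal G_1\otimes\mathcal G_2=\operatorname{Min}_\subseteq(\mathcal G_1\cup\mathcal G_2)$. *)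

(* Defs.v *)
From HB Require Import structures.
From mathcomp Require Import all_boot all_order all_algebra finmap.
From mathcomp Require Import boolp classical_sets reals exp.

Set Implicit Arguments.
Unset Strict Implicit.
Unset Printing Implicit Defensive.

Import Order.TTheory GRing.Theory Num.Theory.
Local Open Scope ring_scope.

(* [Rect a b c d] encodes the closed rectangle [a, b] x [c, d].  The conditions
   a < b and c < d are not bundled: they hold for all elements of [mesh0], and
   [child] preserves them, so on admissible meshes distinct codes are
   distinct rectangles. *)
Record rect (R : realType) :=
  Rect { xmin : R; xmax : R; ymin : R; ymax : R }.

Section RectChoice.
Variable R : realType.

Definition rect_tuple (K : rect R) : R * R * R * R :=
  (xmin K, xmax K, ymin K, ymax K).
Definition tuple_rect (t : R * R * R * R) : rect R :=
  let: (a, b, c, d) := t in Rect a b c d.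

Lemma rect_tupleK : cancel rect_tuple tuple_rect.
Proof. by case. Qed.

HB.instance Definition _ := Choice.copy (rect R) (can_type rect_tupleK).
End RectChoice.

Definition mesh (R : realType) := {fset rect R}.

Section Meshes.
Variable R : realType.
Implicit Types (K : rect R) (G : mesh R) (p q : nat) (k : R).

Definition points K : set (R * R) :=
  [set z | xmin K <= z.1 <= xmax K /\ ymin K <= z.2 <= ymax K]%classic.

Definition area K : R := (xmax K - xmin K) * (ymax K - ymin K).

Definition mid K : R * R := ((xmin K + xmax K) / 2, (ymin K + ymax K) / 2).

Definition level K : R := - (ln (area K) / ln 2).

Definition Dist K1 K2 : R * R :=
  (`|(mid K1).1 - (mid K2).1|, `|(mid K1).2 - (mid K2).2|).

(* Levels are real numbers by definition, but integers on admissible meshes;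
   there the complement of [even_level] is oddness. *)
Definition even_level k : bool := k / 2 \is a Num.int.

Definition D p q k : R * R :=
  if even_level k then
    (2 `^ (- k / 2) * ((p./2)%:R + 1 / 2),
     2 `^ (- k / 2) * ((uphalf q)%:R + 1 / 2))
  else
    (2 `^ (- (k + 1) / 2) * ((uphalf p)%:R + 1 / 2),
     2 `^ (- (k + 1) / 2) * (2 * (q./2)%:R + 1)).

Definition patch p q G K : mesh R :=
  [fset K' in G | ((Dist K' K).1 <= (D p q (level K)).1) &&
                  ((Dist K' K).2 <= (D p q (level K)).2)]%fset.

Definition mesh0 (M N : nat) : mesh R :=
  [fset Rect (m%:R - 1) m%:R (n%:R - 1) n%:R
     | m in iota 1 M, n in iota 1 N]%fset.

Definition child K : mesh R :=
  let: Rect a b c d := K in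
  if even_level (level K) then
    [fset Rect a ((a + b) / 2) c d; Rect ((a + b) / 2) b c d]%fset
  else
    [fset Rect a b c ((c + d) / 2); Rect a b ((c + d) / 2) d]%fset.

Definition bisect G K : mesh R := ((G `\ K) `|` child K)%fset.

Definition admissible_bisect1 p q G K : Prop :=
  K \in G /\ (forall K', K' \in patch p q G K -> level K <= level K').

Fixpoint admissible_bisect_seq p q G (s : seq (rect R)) : Prop :=
  if s is K :: s' then
    admissible_bisect1 p q G K /\ admissible_bisect_seq p q (bisect G K) s'
  else True.

(* [G'] is the result of bisecting the elements of [Ms], and this bisection is
   admissible.  The result does not depend on the order of bisection when [G]
   is an admissible mesh, so it is computed with the order witnessing
   admissibility. *)
Definition admissible_bisect p q G (Ms : mesh R) (G' : mesh R) : Prop :=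
  (Ms `<=` G)%fset /\
  exists s : seq (rect R),
    [/\ perm_eq s (enum_fset Ms), admissible_bisect_seq p q G s
      & G' = foldl bisect G s].

Definition admissible_mesh p q (M N : nat) G : Prop :=
  exists (J : nat) (Gs Ms : nat -> mesh R),
    [/\ Gs 0%N = mesh0 M N, Gs J = G
      & forall j, (j < J)%N -> admissible_bisect p q (Gs j) (Ms j) (Gs j.+1)].

Definition minimal_elements (S : mesh R) : mesh R :=
  [fset K in S | `[< forall K', K' \in S ->
                     (points K' `<=` points K)%classic -> K' = K >]]%fset.

Definition overlay G1 G2 : mesh R := minimal_elements (G1 `|` G2)%fset.

End Meshes.

(* Main.v *)
Require Import Defs.
From mathcomp Require Import all_boot all_order all_algebra finmap.
From mathcomp Require Import boolp classical_sets reals exp.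
From mathcomp Require Import zify ring lra.

(* Every element is a dyadic rectangle, so two elements whose interiors meet are
   nested.  Build G2 from the initial mesh by single bisections, keeping G1
   fixed.  The overlay of G1 with the initial mesh is contained in G1.
   When K in G2 is bisected, #G2 grows by one; the overlay is unchanged if G1
   has an element strictly inside K (each child of K then contains elements of
   G1), and otherwise K is in the overlay and is replaced there by its two
   children. *)

Set Implicit Arguments.
Unset Strict Implicit.
Unset Printing Implicit Defensive.

Import Order.TTheory GRing.Theory Num.Theory.
Local Open Scope ring_scope.

Section DyadicMeshes.
Variable R : realType.
Implicit Types (K L X c : rect R) (G : mesh R).

(** * Rectangles: containment and overlap *)

Definition wf K := (xmin K < xmax K) && (ymin K < ymax K).

Definition sub K L :=
  [&& xmin L <= xmin K, xmax K <= xmax L, ymin L <= ymin K & ymax K <= ymax L].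

(** The inequalities are strict so that, for nondegenerate rectangles, a shared edge or corner does
    not count: the interiors must meet. *)
Definition overlap K L :=
  [&& xmin K < xmax L, xmin L < xmax K, ymin K < ymax L & ymin L < ymax K].

(** Two opposite corners of [K] decide containment; nondegeneracy of [K] makes them points of
    [K]. *)
Lemma points_subP K L : wf K -> (points K `<=` points L)%classic <-> sub K L.
Proof.
move=> /andP[hx hy]; split=> [h|].
  have [] : points L (xmin K, ymin K) by apply: h; split=> /=; lra.
  have [] : points L (xmax K, ymax K) by apply: h; split=> /=; lra.
  move=> /= /andP[_ ?] /andP[_ ?] /andP[? _] /andP[? _].
  exact/and4P.
move=> /and4P[? ? ? ?] z [/andP[? ?] /andP[? ?]]; split; lra.
Qed.

Lemma sub_anti K L : sub K L -> sub L K -> K = L.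
Proof.
case: K L => [a b c d] [a' b' c' d'] /and4P[/= ? ? ? ?] /and4P[/= ? ? ? ?].
by congr Rect; lra.
Qed.

Lemma sub_refl K : sub K K.
Proof. by rewrite /sub !lexx. Qed.

Lemma sub_trans L K X : sub K L -> sub L X -> sub K X.
Proof. by move=> /and4P[? ? ? ?] /and4P[? ? ? ?]; apply/and4P; split; lra. Qed.

Lemma overlapC K L : overlap K L = overlap L K.
Proof. by apply/and4P/and4P=> -[]. Qed.

Lemma overlap_sub c K L : sub c K -> overlap c L -> overlap K L.
Proof. by move=> /and4P[? ? ? ?] /and4P[? ? ? ?]; apply/and4P; split; lra. Qed.

Lemma overlap_refl K : wf K -> overlap K K.
Proof. by move=> /andP[? ?]; apply/and4P. Qed.

Lemma sub_overlap c K : wf c -> sub c K -> overlap K c.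
Proof. by move=> /overlap_refl h /overlap_sub; apply. Qed.

Lemma points_mid K : wf K -> points K (mid K).
Proof. by move=> /andP[? ?]; split; rewrite /=; apply/andP; split; lra. Qed.

Lemma overlap_mid K L : wf K -> points L (mid K) -> overlap K L.
Proof.
by move=> /andP[? ?] [/= /andP[? ?] /andP[? ?]]; apply/and4P; split; lra.
Qed.

(** * Dyadic rectangles and their children *)

(** The form of a cell after [k] halvings of a unit cell. Directions alternate starting with x, so
    [uphalf k] of the cuts halve the width and [k./2] the height. *)
Definition dyadic k K := exists i j : nat,
  K = Rect (i%:R / 2 ^+ uphalf k) (i.+1%:R / 2 ^+ uphalf k)
           (j%:R / 2 ^+ k./2) (j.+1%:R / 2 ^+ k./2).

Lemma exp2_gt0 n : 0 < 2 ^+ n :> R.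
Proof. by rewrite exprn_gt0. Qed.

Lemma dyadic_wf k K : dyadic k K -> wf K.
Proof.
by case=> i [j ->]; rewrite /wf /= !ltr_pM2r ?invr_gt0 ?exp2_gt0 // !ltr_nat !leqnn.
Qed.

(** Over the common denominator [2 ^+ (a + m)] all endpoints become integers, and a strict
    inequality between integers gains a unit. *)
Lemma dyadic_itv_nested (a b i j : nat) : (a <= b)%N ->
  i%:R / 2 ^+ a < j.+1%:R / 2 ^+ b :> R -> j%:R / 2 ^+ b < i.+1%:R / 2 ^+ a :> R ->
  i%:R / 2 ^+ a <= j%:R / 2 ^+ b :> R /\ j.+1%:R / 2 ^+ b <= i.+1%:R / 2 ^+ a :> R.
Proof.
move=> /subnKC <-; move: (b - a)%N => m {b}.
have scale n : n%:R / 2 ^+ a = (n * 2 ^ m)%N%:R / 2 ^+ (a + m) :> R.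
  rewrite natrM natrX exprD; field.
  by rewrite !lt0r_neq0 ?exp2_gt0.
rewrite !scale !ltr_pM2r ?invr_gt0 ?exp2_gt0 // !ler_pM2r ?invr_gt0 ?exp2_gt0 //.
rewrite !ltr_nat !ler_nat; nia.
Qed.

Lemma dyadic_nested k l K L :
  (k <= l)%N -> dyadic k K -> dyadic l L -> overlap K L -> sub L K.
Proof.
move=> kl [i [j ->]] [i' [j' ->]] /and4P[/= x1 x2 y1 y2].
have [? ?] := dyadic_itv_nested (uphalf_leq kl) x1 x2.
have [? ?] := dyadic_itv_nested (half_leq kl) y1 y2.
exact/and4P.
Qed.

Lemma dyadic_overlap_eq k K L : dyadic k K -> dyadic k L -> overlap K L -> K = L.
Proof.
move=> dK dL o; apply: sub_anti.
  by apply: dyadic_nested (leqnn k) dL dK _; rewrite overlapC.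
exact: dyadic_nested (leqnn k) dK dL o.
Qed.

Lemma level_dyadic k K : dyadic k K -> level K = k%:R.
Proof.
case=> i [j ->]; rewrite /level /area /=.
have -> : (i.+1%:R / 2 ^+ uphalf k - i%:R / 2 ^+ uphalf k) *
          (j.+1%:R / 2 ^+ k./2 - j%:R / 2 ^+ k./2) = (2 ^+ k)^-1 :> R.
  have ek : (uphalf k + k./2 = k)%N by rewrite uphalf_half -addnA addnn odd_double_half.
  rewrite -{5}ek exprD -(natr1 i) -(natr1 j); field.
  by rewrite !lt0r_neq0 ?exp2_gt0.
rewrite lnV ?posrE ?exp2_gt0 // lnXn // mulNr opprK -[_ *+ k]mulr_natl mulfK //.
by rewrite gt_eqF // ln_gt0 // ltr1n.
Qed.

Lemma even_level_nat k : even_level (k%:R : R) = ~~ odd k.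
Proof.
apply/idP/idP=> [/intrP[z hz]|ek].
  have /eqP : k%:R = (z * 2)%:~R :> R by rewrite intrM -hz; field.
  by rewrite pmulrn eqr_int => /eqP; lia.
rewrite /even_level; have -> : (k%:R : R) / 2 = (k./2)%:R.
  by rewrite -{1}(even_halfK ek) -muln2 natrM; field.
by rewrite intr_nat.
Qed.

Lemma child_dyadic k K c : dyadic k K -> c \in child K -> dyadic k.+1 c.
Proof.
move=> dK; have := level_dyadic dK; case: dK => i [j ->].
rewrite /child => ->; rewrite even_level_nat /dyadic /= uphalf_half.
have nz n : (2 : R) ^+ n != 0 by rewrite lt0r_neq0 ?exp2_gt0.
have dbl n : n.*2%:R = n%:R * 2 :> R by rewrite -muln2 natrM.
have succ n : n.+1%:R = n%:R + 1 :> R by rewrite natr1.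
(* For odd [k] the cut is in y and the index [j] splits into [2j] and [2j+1]; for even [k] the index
   [i] splits likewise. *)
case: (odd k) => /=; rewrite !inE => /orP[] /eqP ->;
  [exists i, j.*2 | exists i, j.*2.+1 | exists i.*2, j | exists i.*2.+1, j];
  by congr Rect; rewrite ?add1n ?add0n ?exprS ?(succ i.*2.+1) ?(succ j.*2.+1)
    ?(succ i.*2) ?(succ j.*2) ?dbl ?(succ i) ?(succ j); field.
Qed.

Lemma child_sub K c : wf K -> c \in child K -> sub c K.
Proof.
case: K => x x' y y' /andP[/= ? ?]; case: ifP => _;
  by rewrite !inE => /orP[] /eqP ->; apply/and4P; split=> /=; lra.
Qed.

Lemma child_cover K z : points K z -> exists2 c, c \in child K & points c z.
Proof.
case: K => x x' y y' [/= /andP[? ?] /andP[? ?]]; case: ifP => _.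
  have [?|?] := leP z.1 ((x + x') / 2).
    by exists (Rect x ((x + x') / 2) y y');
      [rewrite !inE eqxx | split=> /=; apply/andP; split; lra].
  by exists (Rect ((x + x') / 2) x' y y');
    [rewrite !inE eqxx orbT | split=> /=; apply/andP; split; lra].
have [?|?] := leP z.2 ((y + y') / 2).
  by exists (Rect x x' y ((y + y') / 2));
      [rewrite !inE eqxx | split=> /=; apply/andP; split; lra].
by exists (Rect x x' ((y + y') / 2) y');
    [rewrite !inE eqxx orbT | split=> /=; apply/andP; split; lra].
Qed.

Lemma card_child K : wf K -> #|` child K| = 2%N.
Proof.
case: K => x x' y y' /andP[/= hx hy]; case: ifP => _; rewrite cardfs2.
  by case: eqP => // -[] *; exfalso; lra.
by case: eqP => // -[] *; exfalso; lra.
Qed.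

Lemma child_nonempty K : exists c, c \in child K.
Proof.
by case: K => x x' y y' /=; case: ifP => _; eexists; apply: fset21.
Qed.

(** If [K] lay inside [c], every child of [K] would overlap [c] at the same generation and so equal
    it, but [K] has two children. *)
Lemma not_sub_child k K c : dyadic k K -> c \in child K -> ~~ sub K c.
Proof.
move=> dK cK; apply/negP=> Kc.
have eqc c' : c' \in child K -> c' = c.
  move=> c'K; have dc' := child_dyadic dK c'K.
  apply: (dyadic_overlap_eq dc' (child_dyadic dK cK)); rewrite overlapC.
  apply: sub_overlap (dyadic_wf dc') (sub_trans _ Kc).
  exact: child_sub (dyadic_wf dK) c'K.
have : (child K `<=` [fset c])%fset.
  by apply/fsubsetP=> c' /eqc ->; rewrite inE.
by move=> /fsubset_leq_card; rewrite card_child ?cardfs1 // (dyadic_wf dK).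
Qed.

(** * Dyadic meshes and their bisection *)

Definition covered G : set (R * R) := [set z | exists2 K, K \in G & points K z]%classic.

(** The properties that bisection preserves. The region is a parameter, so that two meshes can be
    required to cover the same one. *)
Record dyadic_mesh (Omega : set (R * R)) G : Prop := DyadicMesh {
  mesh_dyadic : forall K, K \in G -> exists k, dyadic k K;
  mesh_disjoint : forall K L, K \in G -> L \in G -> overlap K L -> K = L;
  mesh_covered : covered G = Omega }.

Lemma mesh_wf Omega G K : dyadic_mesh Omega G -> K \in G -> wf K.
Proof. by move=> hG /(mesh_dyadic hG)[k /dyadic_wf]. Qed.

Lemma mesh_antichain Omega G K L :
  dyadic_mesh Omega G -> K \in G -> L \in G -> sub K L -> K = L.
Proof.
move=> hG KG LG KL; apply: (mesh_disjoint hG) => //; rewrite overlapC.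
exact: sub_overlap (mesh_wf hG KG) KL.
Qed.

Lemma mesh0_dyadic M N K : K \in mesh0 R M N -> dyadic 0 K.
Proof.
move=> /imfset2P[m]; rewrite /= mem_iota => hm [n]; rewrite /= mem_iota => hn ->.
exists m.-1, n.-1; rewrite /= !expr0 !divr1 !prednK; try lia.
by congr Rect; rewrite -subn1 natrB //; lia.
Qed.

Lemma dyadic_mesh0 M N : dyadic_mesh (covered (mesh0 R M N)) (mesh0 R M N).
Proof.
split=> // [K /mesh0_dyadic|K L /mesh0_dyadic dK /mesh0_dyadic dL].
  by exists 0%N.
exact: dyadic_overlap_eq dK dL.
Qed.

Lemma in_bisect G K L :
  (L \in bisect G K) = (L != K) && (L \in G) || (L \in child K).
Proof. by rewrite !inE. Qed.

Lemma dyadic_mesh_bisect Omega G K :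
  dyadic_mesh Omega G -> K \in G -> dyadic_mesh Omega (bisect G K).
Proof.
move=> hG KG; have [k dK] := mesh_dyadic hG KG; have wK := dyadic_wf dK.
(* An overlap with a child is an overlap with [K], which disjointness of [G] forbids. *)
have sep c L : c \in child K -> L != K -> L \in G -> ~~ overlap c L.
  move=> cK LK LG; apply/negP=> /(overlap_sub (child_sub wK cK)).
  by move/(mesh_disjoint hG KG LG) => KL; rewrite KL eqxx in LK.
split.
- move=> L; rewrite in_bisect => /orP[/andP[_ /(mesh_dyadic hG)]//|cK].
  by exists k.+1; apply: child_dyadic cK.
- move=> L L'; rewrite !in_bisect => /orP[/andP[LK LG]|LK] /orP[/andP[L'K L'G]|L'K].
  + exact: mesh_disjoint hG _ _ LG L'G.
  + by rewrite overlapC (negPf (sep _ _ L'K LK LG)).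
  + by rewrite (negPf (sep _ _ LK L'K L'G)).
  + exact: dyadic_overlap_eq (child_dyadic dK LK) (child_dyadic dK L'K).
- rewrite -(mesh_covered hG); apply/seteqP; split=> z [L].
    rewrite in_bisect => /orP[/andP[_ LG]|LK] Lz; first by exists L.
    exists K => //; move: z Lz; apply/points_subP; last exact: child_sub.
    exact: dyadic_wf (child_dyadic dK LK).
  move=> LG Lz; have [LK|LK] := eqVneq L K.
    rewrite LK in Lz; have [c cK cz] := child_cover Lz.
    by exists c => //; rewrite in_bisect cK orbT.
  by exists L => //; rewrite in_bisect LK LG.
Qed.

Lemma card_bisect Omega G K :
  dyadic_mesh Omega G -> K \in G -> #|` bisect G K| = #|` G|.+1.
Proof.
move=> hG KG; have [k dK] := mesh_dyadic hG KG; have wK := dyadic_wf dK.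
rewrite cardfsU (cardfsD1 K G) KG card_child //.
(* No child is already in [G]: it would lie inside [K], hence equal [K]. *)
suff -> : ((G `\ K) `&` child K = fset0)%fset by rewrite cardfs0; lia.
apply/fsetP=> c; rewrite !inE; apply/negP=> /andP[/andP[cK cG] cc].
by rewrite (mesh_antichain hG cG KG (child_sub wK cc)) eqxx in cK.
Qed.

(** * Overlays and the effect of one bisection *)

Lemma in_overlay Omega G1 G2 K : dyadic_mesh Omega G1 -> dyadic_mesh Omega G2 ->
  K \in overlay G1 G2 <->
  K \in (G1 `|` G2)%fset /\ forall L, L \in (G1 `|` G2)%fset -> sub L K -> L = K.
Proof.
move=> h1 h2; have wfU L : L \in (G1 `|` G2)%fset -> wf L.
  by rewrite inE => /orP[]; [apply: mesh_wf h1|apply: mesh_wf h2].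
rewrite /overlay /minimal_elements [_ \in _]in_fset /= [_ \in _]inE /=; split.
  move=> /andP[KU /asboolP h]; split=> // L LU LK.
  by apply: h => //; apply/points_subP => //; apply: wfU.
move=> [KU h]; rewrite KU; apply/asboolP=> L LU LK.
by apply: h => //; apply/points_subP => //; apply: wfU.
Qed.

(** The midpoint of [K] is covered by some [X] in [G1]; being interior to [K], it forces an overlap
    even when it is on the boundary of [X]. *)
Lemma mesh_overlap Omega G1 G2 K :
  dyadic_mesh Omega G1 -> dyadic_mesh Omega G2 -> K \in G2 ->
  exists2 X, X \in G1 & overlap K X.
Proof.
move=> h1 h2 KG; have wK := mesh_wf h2 KG.
have : Omega (mid K) by rewrite -(mesh_covered h2); exists K => //; apply: points_mid.
by rewrite -(mesh_covered h1) => -[X XG /(overlap_mid wK)]; exists X.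
Qed.

Lemma overlay_mesh0_sub M N G :
  dyadic_mesh (covered (mesh0 R M N)) G -> (overlay G (mesh0 R M N) `<=` G)%fset.
Proof.
move=> hG; apply/fsubsetP=> K /(in_overlay _ hG (dyadic_mesh0 M N))[].
rewrite inE => /orP[//|K0 Kmin].
have [X XG KX] := mesh_overlap hG (dyadic_mesh0 M N) K0.
have [k dX] := mesh_dyadic hG XG.
(* Nothing is coarser than generation 0, so [X] lies in the initial cell [K], and minimality gives
   [X = K]. *)
by rewrite -(Kmin X) ?inE ?XG //; apply: dyadic_nested (leq0n k) (mesh0_dyadic K0) dX KX.
Qed.

Lemma overlay_bisect_old Omega G1 G2 K L :
  dyadic_mesh Omega G1 -> dyadic_mesh Omega G2 -> K \in G2 ->
  L \in overlay G1 (bisect G2 K) -> L \notin child K ->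
  L \in (overlay G1 G2 `\ K)%fset.
Proof.
move=> h1 h2 KG /(in_overlay _ h1 (dyadic_mesh_bisect h2 KG))[LU Lmin] LK.
(* An [L] containing [K] would contain a child of [K] and, by minimality, be that child. Hence
   putting [K] back does not affect the minimality of [L]. *)
have nKL : ~~ sub K L.
  apply/negP=> KL; have [c cK] := child_nonempty K.
  have cL : c = L.
    apply: Lmin; first by rewrite in_fsetU in_bisect cK !orbT.
    exact: sub_trans (child_sub (mesh_wf h2 KG) cK) KL.
  by rewrite -cL cK in LK.
rewrite in_fsetD1; apply/andP; split.
  by apply/negP=> /eqP LeqK; rewrite LeqK sub_refl in nKL.
apply/(in_overlay _ h1 h2); split.
  move: LU; rewrite in_fsetU in_bisect in_fsetU (negPf LK) orbF.
  by move=> /orP[->//|/andP[_ ->]]; rewrite orbT.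
move=> X XU XL; apply: Lmin => //; have [XK|XK] := eqVneq X K.
  by rewrite -XK XL in nKL.
move: XU; rewrite in_fsetU => XU; rewrite in_fsetU in_bisect XK.
by case/orP: XU => ->; rewrite ?orbT.
Qed.

Lemma overlay_bisect_refined Omega G1 G2 K X :
  dyadic_mesh Omega G1 -> dyadic_mesh Omega G2 -> K \in G2 ->
  X \in G1 -> sub X K -> X != K ->
  (overlay G1 (bisect G2 K) `<=` overlay G1 G2)%fset.
Proof.
move=> h1 h2 KG XG XK neqXK; have [k dK] := mesh_dyadic h2 KG.
have h2' := dyadic_mesh_bisect h2 KG.
apply/fsubsetP=> c cO; have [cK|cK] := boolP (c \in child K); last first.
  by have := overlay_bisect_old h1 h2 KG cO cK; rewrite in_fsetD1 => /andP[].
have scK := child_sub (dyadic_wf dK) cK.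
move: cO => /(in_overlay _ h1 h2')[_ cmin].
(* Some [Y] in [G1] overlaps [c]. If [Y] is no finer than [K], then [X] lies in [K] and [K] in [Y],
   so [X = Y = K], a contradiction. Otherwise [Y] lies in [c], and minimality gives [Y = c]. *)
have cG1 : c \in G1.
  have cG2' : c \in bisect G2 K by rewrite in_bisect cK orbT.
  have [Y YG ocY] := mesh_overlap h1 h2' cG2'; have [l dY] := mesh_dyadic h1 YG.
  have [lk|kl] := leqP l k.
    have KY : sub K Y.
      apply: dyadic_nested lk dY dK _; rewrite overlapC.
      exact: overlap_sub scK ocY.
    have XY : X = Y := mesh_antichain h1 XG YG (sub_trans XK KY).
    by rewrite -XY in KY; rewrite (sub_anti XK KY) eqxx in neqXK.
  rewrite -(cmin Y) ?in_fsetU ?YG //.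
  exact: dyadic_nested kl (child_dyadic dK cK) dY ocY.
apply/(in_overlay _ h1 h2); split=> [|Y]; first by rewrite in_fsetU cG1.
rewrite in_fsetU => /orP[YG|YG] Yc; first exact: mesh_antichain h1 YG cG1 Yc.
(* An element of [G2] below [c] is below [K], hence is [K], which does not fit into its own
   child. *)
have YK := mesh_antichain h2 YG KG (sub_trans Yc scK).
by rewrite YK (negPf (not_sub_child dK cK)) in Yc.
Qed.

Lemma card_overlay_bisect Omega G1 G2 K :
  dyadic_mesh Omega G1 -> dyadic_mesh Omega G2 -> K \in G2 ->
  (#|` overlay G1 (bisect G2 K)| <= #|` overlay G1 G2|.+1)%N.
Proof.
move=> h1 h2 KG.
have [[X [XG XK neqXK]]|noX] := pselect (exists X, [/\ X \in G1, sub X K & X != K]).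
  apply: leq_trans (leqnSn _); apply: fsubset_leq_card.
  exact: overlay_bisect_refined h1 h2 KG XG XK neqXK.
have KO : K \in overlay G1 G2.
  apply/(in_overlay _ h1 h2); split=> [|Y]; first by rewrite in_fsetU KG orbT.
  rewrite in_fsetU => /orP[YG|YG] YK; last exact: mesh_antichain h2 YG KG YK.
  by apply: contra_notP noX => /eqP neqYK; exists Y.
(* Dropping [K] and adding at most its two children raises the count by at most one. *)
rewrite (cardfsD1 K (overlay G1 G2)) KO.
have /fsubset_leq_card : (overlay G1 (bisect G2 K) `<=`
    (overlay G1 G2 `\ K) `|` child K)%fset.
  apply/fsubsetP=> L LO; rewrite in_fsetU.
  have [|LK] := boolP (L \in child K); first by rewrite orbT.
  by rewrite (overlay_bisect_old h1 h2 KG LO LK).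
by rewrite cardfsU card_child ?(mesh_wf h2 KG) //; lia.
Qed.

(** * Induction along the admissible bisections *)

(** The induction invariant for a fixed [G1]; the first conjunct is what allows the next bisection
    step. *)
Definition overlay_bound M N G1 G :=
  dyadic_mesh (covered (mesh0 R M N)) G /\
  (#|` overlay G1 G| + #|` mesh0 R M N| <= #|` G1| + #|` G|)%N.

Lemma overlay_bound_foldl p q M N G1 G s :
  dyadic_mesh (covered (mesh0 R M N)) G1 -> admissible_bisect_seq p q G s ->
  overlay_bound M N G1 G -> overlay_bound M N G1 (foldl (@bisect R) G s).
Proof.
move=> h1; elim: s G => [//|K s IHs] G /= [[KG _] adm] [hG bound].
apply: IHs => //; split; first exact: dyadic_mesh_bisect.
have := card_overlay_bisect h1 hG KG; rewrite (card_bisect hG KG); lia.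
Qed.

Lemma admissible_overlay_bound p q M N G1 G :
  dyadic_mesh (covered (mesh0 R M N)) G1 -> admissible_mesh p q M N G ->
  overlay_bound M N G1 G.
Proof.
move=> h1 [J [Gs [Ms [G0 <- step]]]].
elim: J step => [_|J IHJ step].
  rewrite G0; split; first exact: dyadic_mesh0.
  by rewrite leq_add2r fsubset_leq_card ?overlay_mesh0_sub.
have [_ [s [_ adm ->]]] := step J (ltnSn J).
by apply: overlay_bound_foldl adm _ => //; apply: IHJ => j /ltnW; apply: step.
Qed.

End DyadicMeshes.

Theorem lemma4p4 (R : realType) (p q M N : nat)
    (hp : (2 <= p)%N) (hq : (2 <= q)%N) (hM : (0 < M)%N) (hN : (0 < N)%N)
    (G1 G2 : mesh R)
    (hG1 : admissible_mesh p q M N G1) (hG2 : admissible_mesh p q M N G2) :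
  (#|` overlay G1 G2 | + #|` mesh0 R M N | <= #|` G1 | + #|` G2 |)%N.
Proof.
(* A first run against the initial mesh, only to learn that [G1] is a dyadic mesh; the second run
   then builds [G2] against [G1]. *)
have [h1 _] := admissible_overlay_bound (dyadic_mesh0 R M N) hG1.
by have [] := admissible_overlay_bound h1 hG2.
Qed.
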